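(* Let $k$ be a field, let $(\mathcal{C},\otimes,I)$ be a strict tensor category whose underlying category is a small $k$-linear abelian category, and let $(\mathcal{F},\mathrm{Id},\mathcal{F}_2)$ be a tensor functor from $\mathcal{C}$ to the category $\mathrm{Vect}_k^f$ of finite dimensional $k$-vector spaces, with $\mathcal{F}$ $k$-linear. Let $\{i_X:\mathrm{Hom}(X,X)\to\mathrm{coend}(\mathcal{F})\}_{X\in\mathrm{Ob}(\mathcal{C})}$ be a realization of $\mathrm{coend}(\mathcal{F})$, with its induced comultiplication $\Delta$ and counit $\epsilon$. Let $m:\mathrm{coend}(\mathcal{F})\otimes\mathrm{coend}(\mathcal{F})\to\mathrm{coend}(\mathcal{F})$ be the linear map determined by $$m\big(i_X(S)\otimes i_Y(T)\big)=i_{X\otimes Y}\big((\mathcal{F}_2)_{X,Y}\circ(S\otimes T)\circ(\mathcal{F}_2)_{X,Y}^{-1}\big)$$ for all $X,Y\in\mathrm{Ob}(\mathcal{C})$, $S\in\mathrm{Hom}(X,X)$, $T\in\mathrm{Hom}(Y,Y)$, and let $\eta:=i_I:k=\mathrm{Hom}_k(\mathcal{F}(I),\mathcal{F}(I))\to\mathrm{coend}(\mathcal{F})$. Then $(\mathrm{coend}(\mathcal{F}),\Delta,\epsilon,m,\eta)$ is a bialgebra over $k$.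
   Context: For objects $X,Y$ of $\mathcal{C}$ write $\mathrm{Hom}(X,Y):=\mathrm{Hom}_k(\mathcal{F}(X),\mathcal{F}(Y))$ (all $k$-linear maps); tensor products of vector spaces are over $k$. Tensor functor: $\mathcal{F}(I)=k$ with unit constraint the identity, and $\mathcal{F}_2$ is a natural isomorphism with components $(\mathcal{F}_2)_{X,Y}:\mathcal{F}(X)\otimes\mathcal{F}(Y)\to\mathcal{F}(X\otimes Y)$ satisfying the usual associativity and unit coherence conditions of a (strong) monoidal functor. A realization of $\mathrm{coend}(\mathcal{F})$ is a $k$-vector space (here denoted $\mathrm{coend}(\mathcal{F})$) together with linear maps $\{i_X:\mathrm{Hom}(X,X)\to\mathrm{coend}(\mathcal{F})\}_{X\in\mathrm{Ob}(\mathcal{C})}$ such that: (1) for all objects $X,Y$, all $f\in\mathrm{Hom}_{\mathcal{C}}(Y,X)$ and all $T\in\mathrm{Hom}(X,Y)$, $i_X(\mathcal{F}(f)\circ T)=i_Y(T\circ\mathcal{F}(f))$; (2) for every $k$-vector space $W$ with linear maps $\{i_X^W:\mathrm{Hom}(X,X)\to W\}_{X\in\mathrm{Ob}(\mathcal{C})}$ satisfying the analogue of (1), there is a unique linear map $\varphi:\mathrm{coend}(\mathcal{F})\to W$ with $\varphi\circ i_X=i_X^W$ for all $X\in\mathrm{Ob}(\mathcal{C})$. Coalgebra structure: for $\beta\in\mathcal{F}(X)^*$ and $x\in\mathcal{F}(X)$, $\beta\otimes x\in\mathrm{Hom}(X,X)$ denotes the map $y\mapsto\beta(y)x$; such maps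 span $\mathrm{Hom}(X,X)$. With $\{x_i\}_{i=1}^n$ a basis of $\mathcal{F}(X)$ and $\{x^i\}_{i=1}^n$ its dual basis, $\mathrm{Hom}(X,X)$ is a coalgebra via $\Delta_X(\beta\otimes x)=\sum_{i=1}^n(\beta\otimes x_i)\otimes(x^i\otimes x)$ and $\epsilon_X(\beta\otimes x)=\beta(x)$. The induced maps $\Delta:\mathrm{coend}(\mathcal{F})\to\mathrm{coend}(\mathcal{F})\otimes\mathrm{coend}(\mathcal{F})$ and $\epsilon:\mathrm{coend}(\mathcal{F})\to k$ are the unique linear maps with $\Delta\circ i_X=(i_X\otimes i_X)\circ\Delta_X$ and $\epsilon\circ i_X=\epsilon_X$ for all $X\in\mathrm{Ob}(\mathcal{C})$. *)

(* Defs.v *)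
From HB Require Import structures.
From mathcomp Require Import all_boot all_order all_algebra sesquilinear ring_quotient.
From mathcomp Require Import boolp.
From mathcomp.multinomials Require Import freeg.

Set Implicit Arguments.
Unset Strict Implicit.
Unset Printing Implicit Defensive.

Import GRing.Theory.
Local Open Scope ring_scope.
Local Open Scope quotient_scope.

(* Tensor product of vector spaces over k, as the quotient of the free vector
   space on U * V by the usual relations. *)

Section TensorType.
Variables (k : fieldType) (U V : lmodType k).

Local Notation gen u v := (<< (u, v) >> : {freeg (U * V) / k}).

Inductive tensor_rel : {freeg (U * V) / k} -> Prop :=
| tensor_relDl u u' v : tensor_rel (gen (u + u') v - gen u v - gen u' v)
| tensor_relDr u v v' : tensor_rel (gen u (v + v') - gen u v - gen u v')
| tensor_relZl a u v : tensor_rel (gen (a *: u) v - a *: gen u v)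
| tensor_relZr a u v : tensor_rel (gen u (a *: v) - a *: gen u v)
| tensor_rel0 : tensor_rel 0
| tensor_relP a x y : tensor_rel x -> tensor_rel y -> tensor_rel (a *: x + y).

Definition tensor_relb : {pred {freeg (U * V) / k}} := fun x => `[< tensor_rel x >].

Lemma tensor_relb_closed : zmod_closed tensor_relb.
Proof.
split; first exact/asboolP/tensor_rel0.
move=> x y /asboolP hx /asboolP hy; apply/asboolP.
by rewrite addrC -scaleN1r; apply: tensor_relP.
Qed.

HB.instance Definition _ :=
  GRing.isZmodClosed.Build _ tensor_relb tensor_relb_closed.

Definition tensor : Type := Quotient.quot [the zmodClosed _ of tensor_relb].

HB.instance Definition _ := GRing.Zmodule.on tensor.
HB.instance Definition _ := EqQuotient.on tensor.

Definition tensor_pi (x : {freeg (U * V) / k}) : tensor :=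
  \pi_(Quotient.quot [the zmodClosed _ of tensor_relb]) x.

Lemma tensor_piB x y : tensor_pi (x - y) = tensor_pi x - tensor_pi y.
Proof. by rewrite /tensor_pi; exact: (raddfB (\pi_(Quotient.quot [the zmodClosed _ of tensor_relb]))). Qed.
Lemma tensor_pi0 : tensor_pi 0 = 0.
Proof. by have := tensor_piB 0 0; rewrite !subrr. Qed.
Lemma tensor_piN x : tensor_pi (- x) = - tensor_pi x.
Proof. by rewrite -[- x]sub0r tensor_piB tensor_pi0 sub0r. Qed.
Lemma tensor_piD x y : tensor_pi (x + y) = tensor_pi x + tensor_pi y.
Proof. by rewrite -[y in LHS]opprK tensor_piB tensor_piN opprK. Qed.

Lemma tensor_pi_eq x y : tensor_pi x = tensor_pi y <-> tensor_rel (x - y).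
Proof.
split.
  move=> /eqP; rewrite /tensor_pi -Quotient.idealrBE => h.
  by apply/asboolP.
move=> h; apply/eqP; rewrite /tensor_pi -Quotient.idealrBE.
exact/asboolP.
Qed.

Lemma tensor_reprK (t : tensor) : tensor_pi (repr t) = t.
Proof. exact: reprK. Qed.

Definition tensor_scale (a : k) (t : tensor) : tensor := tensor_pi (a *: repr t).

Lemma tensor_relZ a x : tensor_rel x -> tensor_rel (a *: x).
Proof. by move=> h; rewrite -[a *: x]addr0; apply: tensor_relP h tensor_rel0. Qed.

Lemma tensor_scale_pi a x : tensor_scale a (tensor_pi x) = tensor_pi (a *: x).
Proof.
apply/tensor_pi_eq; rewrite -scalerBr; apply: tensor_relZ.
by apply/tensor_pi_eq; rewrite tensor_reprK.
Qed.

Lemma tensor_scaleA a b t : tensor_scale a (tensor_scale b t) = tensor_scale (a * b) t.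
Proof. by rewrite -(tensor_reprK t) !tensor_scale_pi scalerA. Qed.
Lemma tensor_scale1 : left_id 1 tensor_scale.
Proof. by move=> t; rewrite -(tensor_reprK t) !tensor_scale_pi scale1r. Qed.
Lemma tensor_scaleDr : right_distributive tensor_scale +%R.
Proof.
move=> a s t; rewrite -(tensor_reprK s) -(tensor_reprK t).
by rewrite -tensor_piD !tensor_scale_pi scalerDr tensor_piD.
Qed.
Lemma tensor_scaleDl t : {morph tensor_scale^~ t : a b / a + b}.
Proof.
by move=> a b; rewrite -(tensor_reprK t) !tensor_scale_pi scalerDl tensor_piD.
Qed.

HB.instance Definition _ := GRing.Zmodule_isLmodule.Build k tensor
  tensor_scaleA tensor_scale1 tensor_scaleDr tensor_scaleDl.

Lemma tensor_piZ a x : tensor_pi (a *: x) = a *: tensor_pi x.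
Proof. by rewrite -tensor_scale_pi. Qed.

Definition tmul (u : U) (v : V) : tensor := tensor_pi (gen u v).

Lemma tmul_bilinear : bilinear_for *:%R *:%R tmul.
Proof.
split=> [v a u u'|u a v v'] /=; rewrite /tmul.
  transitivity (tensor_pi (gen (a *: u) v + gen u' v)).
    by apply/tensor_pi_eq; rewrite opprD addrA; apply: tensor_relDl.
  rewrite tensor_piD -tensor_piZ; congr (_ + _).
  exact/tensor_pi_eq/tensor_relZl.
transitivity (tensor_pi (gen u (a *: v) + gen u v')).
  by apply/tensor_pi_eq; rewrite opprD addrA; apply: tensor_relDr.
rewrite tensor_piD -tensor_piZ; congr (_ + _).
exact/tensor_pi_eq/tensor_relZr.
Qed.

HB.instance Definition _ :=
  bilinear_isBilinear.Build k U V tensor *:%R *:%R tmul tmul_bilinear.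

Lemma tmulPl a u u' v : tmul (a *: u + u') v = a *: tmul u v + tmul u' v.
Proof. exact: linearPl. Qed.
Lemma tmulPr a u v v' : tmul u (a *: v + v') = a *: tmul u v + tmul u v'.
Proof. exact: linearPr. Qed.

Lemma tmulZl a u v : tmul (a *: u) v = a *: tmul u v.
Proof. exact: linearZl_LR. Qed.
Lemma tmulZr a u v : tmul u (a *: v) = a *: tmul u v.
Proof. exact: linearZr_LR. Qed.
Lemma tmul_suml n (F : 'I_n -> U) v :
  tmul (\sum_i F i) v = \sum_i tmul (F i) v.
Proof. exact: linear_sumlz. Qed.
Lemma tmul_sumr n u (F : 'I_n -> V) :
  tmul u (\sum_i F i) = \sum_i tmul u (F i).
Proof. exact: linear_sumr. Qed.

Section Lift.
Variables (W : lmodType k) (f : {bilinear U -> V -> W}).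

Let flift : {freeg (U * V) / k} -> W := fglift (fun p : U * V => f p.1 p.2).

Let flB : {morph flift : x y / x - y}.
Proof. exact: lift_is_additive. Qed.

Let flift_linear : linear flift.
Proof.
have fl0 : flift 0 = 0 by rewrite -(subrr 0) flB subrr.
have flD : {morph flift : x y / x + y}.
  by move=> x y; rewrite -{1}[y]opprK flB -[- y]sub0r flB fl0 sub0r opprK.
have flsum (I : Type) (r : seq I) (F : I -> {freeg (U * V) / k}) :
    flift (\sum_(i <- r) F i) = \sum_(i <- r) flift (F i).
  by elim/big_rec2: _ => [|i x y _ <-]; rewrite ?fl0 ?flD.
move=> a x y; rewrite flD; congr (_ + _).
rewrite -{2}(freeg_sumE x) {1}/GRing.scale /= /fgscale !flsum scaler_sumr.
by apply: eq_bigr => z _; rewrite /flift !liftU scalerA.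
Qed.

Let fliftU u v : flift (gen u v) = f u v.
Proof. by rewrite /flift liftU scale1r. Qed.

Let flift_rel x : tensor_rel x -> flift x = 0.
Proof.
have flP := flift_linear.
have fl0 : flift 0 = 0 by rewrite -(subrr 0) flB subrr.
have flZ a x' : flift (a *: x') = a *: flift x'.
  by rewrite -[a *: x']addr0 flP fl0 addr0.
elim=> [u u' v|u v v'|a u v|a u v||a x' y' _ hx _ hy].
- by rewrite !flB !fliftU linearDl addrAC addrK subrr.
- by rewrite !flB !fliftU linearDr addrAC addrK subrr.
- by rewrite flB flZ !fliftU linearZl_LR subrr.
- by rewrite flB flZ !fliftU linearZr_LR subrr.
- exact: fl0.
- by rewrite flP hx hy scaler0 addr0.
Qed.

Definition tensor_lift (t : tensor) : W := flift (repr t).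

Let tensor_lift_pi x : tensor_lift (tensor_pi x) = flift x.
Proof.
apply/eqP; rewrite -subr_eq0 /tensor_lift; apply/eqP.
rewrite -flB; apply: flift_rel; apply/tensor_pi_eq; exact: tensor_reprK.
Qed.

Lemma tensor_lift_linear : linear tensor_lift.
Proof.
move=> a s t; rewrite -(tensor_reprK s) -(tensor_reprK t).
by rewrite -tensor_piZ -tensor_piD !tensor_lift_pi flift_linear.
Qed.

HB.instance Definition _ :=
  GRing.isLinear.Build k tensor W *:%R tensor_lift tensor_lift_linear.

Lemma tensor_liftE u v : tensor_lift (tmul u v) = f u v.
Proof. by rewrite /tmul tensor_lift_pi fliftU. Qed.

End Lift.

Lemma tensor_ind (P : tensor -> Prop) :
  (forall u v, P (tmul u v)) -> (forall s t, P s -> P t -> P (s + t)) ->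
  forall t, P t.
Proof.
move=> Pg PD t; rewrite -(tensor_reprK t); move: (repr t) => x.
have P0 : P 0 by rewrite -(linear0r tmul 0); apply: Pg.
rewrite -(freeg_sumE x).
elim: (dom x) => [|[u v] r IH]; first by rewrite big_nil tensor_pi0.
rewrite big_cons tensor_piD; apply: PD => //.
suff -> : tensor_pi << coeff (u, v) x *g (u, v) >> = tmul (coeff (u, v) x *: u) v.
  exact: Pg.
rewrite (linearZl_LR tmul) /= /tmul -tensor_piZ; congr tensor_pi.
by apply/eqP/freeg_eqP => z; rewrite coeffZ !coeffU mul1r.
Qed.

Lemma tensor_ext (W : lmodType k) (f g : {linear tensor -> W}) :
  (forall u v, f (tmul u v) = g (tmul u v)) -> f =1 g.
Proof. by move=> h; elim/tensor_ind => [//|s t hs ht]; rewrite !linearD hs ht. Qed.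

End TensorType.

Notation "U '\ox' V" := (tensor U V) (at level 40, left associativity) : type_scope.
Notation "u '*t' v" := (tmul u v) (at level 40, left associativity) : ring_scope.

Section TensorMap.
Variables (k : fieldType) (U V U' V' : lmodType k).
Variables (f : {linear U -> U'}) (g : {linear V -> V'}).

Definition tensor_map_fun (u : U) (v : V) : U' \ox V' := f u *t g v.

Lemma tensor_map_fun_bilinear : bilinear_for *:%R *:%R tensor_map_fun.
Proof.
split=> [v a u u'|u a v v'] /=; rewrite /tensor_map_fun linearP.
  exact: tmulPl.
exact: tmulPr.
Qed.

HB.instance Definition _ := bilinear_isBilinear.Build k U V (U' \ox V') *:%R *:%R
  tensor_map_fun tensor_map_fun_bilinear.

Definition tensor_map : U \ox V -> U' \ox V' := tensor_lift tensor_map_fun.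

HB.instance Definition _ := GRing.Linear.on tensor_map.

Lemma tensor_mapE u v : tensor_map (u *t v) = f u *t g v.
Proof. exact: tensor_liftE. Qed.

End TensorMap.

Section TensorAssoc.
Variables (k : fieldType) (U V W : lmodType k).

Definition tensor_assoc_fun2 (w : W) (u : U) (v : V) : U \ox (V \ox W) :=
  u *t (v *t w).

Lemma tensor_assoc_fun2_bilinear w :
  bilinear_for *:%R *:%R (tensor_assoc_fun2 w).
Proof.
split=> [v a u u'|u a v v'] /=; rewrite /tensor_assoc_fun2.
  exact: tmulPl.
by rewrite tmulPl tmulPr.
Qed.

HB.instance Definition _ w := bilinear_isBilinear.Build k U V (U \ox (V \ox W))
  *:%R *:%R (tensor_assoc_fun2 w) (tensor_assoc_fun2_bilinear w).

Definition tensor_assoc_fun (t : U \ox V) (w : W) : U \ox (V \ox W) :=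
  tensor_lift (tensor_assoc_fun2 w) t.

Lemma tensor_assoc_fun_bilinear : bilinear_for *:%R *:%R tensor_assoc_fun.
Proof.
split=> [w a s t|t a w w'] /=; rewrite /tensor_assoc_fun; first exact: linearP.
elim/tensor_ind: t => [u v|s t hs ht].
  by rewrite !tensor_liftE /= /tensor_assoc_fun2 /= !tmulPr.
by rewrite !linearD /= hs ht addrACA.
Qed.

HB.instance Definition _ := bilinear_isBilinear.Build k (U \ox V) W
  (U \ox (V \ox W)) *:%R *:%R tensor_assoc_fun tensor_assoc_fun_bilinear.

Definition tensor_assoc : (U \ox V) \ox W -> U \ox (V \ox W) :=
  tensor_lift tensor_assoc_fun.

HB.instance Definition _ := GRing.Linear.on tensor_assoc.

Lemma tensor_assocE u v w : tensor_assoc ((u *t v) *t w) = u *t (v *t w).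
Proof. by rewrite /tensor_assoc tensor_liftE /= /tensor_assoc_fun /= tensor_liftE. Qed.

End TensorAssoc.
Arguments tensor_assoc {k U V W}.

Section TensorAssocInv.
Variables (k : fieldType) (U V W : lmodType k).

Definition tensor_unassoc_fun2 (u : U) (v : V) (w : W) : (U \ox V) \ox W :=
  (u *t v) *t w.

Lemma tensor_unassoc_fun2_bilinear u :
  bilinear_for *:%R *:%R (tensor_unassoc_fun2 u).
Proof.
split=> [w a v v'|v a w w'] /=; rewrite /tensor_unassoc_fun2.
  by rewrite tmulPr tmulPl.
exact: tmulPr.
Qed.

HB.instance Definition _ u := bilinear_isBilinear.Build k V W ((U \ox V) \ox W)
  *:%R *:%R (tensor_unassoc_fun2 u) (tensor_unassoc_fun2_bilinear u).

Definition tensor_unassoc_fun (u : U) (t : V \ox W) : (U \ox V) \ox W :=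
  tensor_lift (tensor_unassoc_fun2 u) t.

Lemma tensor_unassoc_fun_bilinear : bilinear_for *:%R *:%R tensor_unassoc_fun.
Proof.
split=> [t a u u'|u a s t] /=; rewrite /tensor_unassoc_fun; last exact: linearP.
elim/tensor_ind: t => [v w|s t hs ht].
  by rewrite !tensor_liftE /= /tensor_unassoc_fun2 /= !tmulPl.
by rewrite !linearD /= hs ht addrACA.
Qed.

HB.instance Definition _ := bilinear_isBilinear.Build k U (V \ox W)
  ((U \ox V) \ox W) *:%R *:%R tensor_unassoc_fun tensor_unassoc_fun_bilinear.

Definition tensor_unassoc : U \ox (V \ox W) -> (U \ox V) \ox W :=
  tensor_lift tensor_unassoc_fun.

HB.instance Definition _ := GRing.Linear.on tensor_unassoc.

Lemma tensor_unassocE u v w : tensor_unassoc (u *t (v *t w)) = (u *t v) *t w.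
Proof.
by rewrite /tensor_unassoc tensor_liftE /= /tensor_unassoc_fun /= tensor_liftE.
Qed.

End TensorAssocInv.
Arguments tensor_unassoc {k U V W}.

Section TensorSwapUnit.
Variables (k : fieldType) (U V : lmodType k).

Definition tensor_swap_fun (u : U) (v : V) : V \ox U := v *t u.

Lemma tensor_swap_fun_bilinear : bilinear_for *:%R *:%R tensor_swap_fun.
Proof.
split=> [v a u u'|u a v v'] /=; rewrite /tensor_swap_fun.
  exact: tmulPr.
exact: tmulPl.
Qed.

HB.instance Definition _ := bilinear_isBilinear.Build k U V (V \ox U) *:%R *:%R
  tensor_swap_fun tensor_swap_fun_bilinear.

Definition tensor_swap : U \ox V -> V \ox U := tensor_lift tensor_swap_fun.

HB.instance Definition _ := GRing.Linear.on tensor_swap.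

Lemma tensor_swapE u v : tensor_swap (u *t v) = v *t u.
Proof. exact: tensor_liftE. Qed.

Definition tensor_lunit_fun (a : k^o) (v : V) : V := (a : k) *: v.

Lemma tensor_lunit_fun_bilinear : bilinear_for *:%R *:%R tensor_lunit_fun.
Proof.
split=> [v a b b'|b a v v'] /=; rewrite /tensor_lunit_fun.
  by rewrite scalerDl scalerA.
by rewrite scalerDr !scalerA mulrC.
Qed.

HB.instance Definition _ := bilinear_isBilinear.Build k k^o V V *:%R *:%R
  tensor_lunit_fun tensor_lunit_fun_bilinear.

Definition tensor_lunit : k^o \ox V -> V := tensor_lift tensor_lunit_fun.

HB.instance Definition _ := GRing.Linear.on tensor_lunit.

Lemma tensor_lunitE (a : k^o) v : tensor_lunit (a *t v) = (a : k) *: v.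
Proof. exact: tensor_liftE. Qed.

End TensorSwapUnit.
Arguments tensor_swap {k U V}.
Arguments tensor_lunit {k V}.

Section TensorRunit.
Variables (k : fieldType) (V : lmodType k).

Definition tensor_runit (t : V \ox k^o) : V := tensor_lunit (tensor_swap t).

Lemma tensor_runit_linear : linear tensor_runit.
Proof. by move=> a s t; rewrite /tensor_runit !linearP. Qed.

HB.instance Definition _ := GRing.isLinear.Build k (V \ox k^o) V *:%R
  tensor_runit tensor_runit_linear.

Lemma tensor_runitE v (a : k^o) : tensor_runit (v *t a) = (a : k) *: v.
Proof. by rewrite /tensor_runit tensor_swapE tensor_lunitE. Qed.

End TensorRunit.
Arguments tensor_runit {k V}.

Section TensorMidswap.
Variables (k : fieldType) (A B C D : lmodType k).

Definition tensor_midswap (t : (A \ox B) \ox (C \ox D)) :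
    (A \ox C) \ox (B \ox D) :=
  tensor_unassoc (tensor_map idfun
    (tensor_assoc \o tensor_map tensor_swap idfun \o tensor_unassoc)
    (tensor_assoc t)).

Lemma tensor_midswap_linear : linear tensor_midswap.
Proof. by move=> a s t; rewrite /tensor_midswap !linearP. Qed.

HB.instance Definition _ := GRing.isLinear.Build k ((A \ox B) \ox (C \ox D))
  ((A \ox C) \ox (B \ox D)) *:%R tensor_midswap tensor_midswap_linear.

Lemma tensor_midswapE a b c d :
  tensor_midswap ((a *t b) *t (c *t d)) = (a *t c) *t (b *t d).
Proof.
by rewrite /tensor_midswap tensor_assocE tensor_mapE /= tensor_unassocE
  tensor_mapE /= tensor_swapE tensor_assocE tensor_unassocE.
Qed.

End TensorMidswap.
Arguments tensor_midswap {k A B C D}.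

Section Bialgebra.
Variables (k : fieldType) (A : lmodType k).
Variables (Delta : {linear A -> A \ox A}) (eps : {linear A -> k^o}).
Variables (m : {linear A \ox A -> A}) (eta : {linear k^o -> A}).

Record is_coalgebra : Prop := {
  coalgebra_coassoc : forall a,
    tensor_assoc (tensor_map Delta idfun (Delta a)) =
    tensor_map idfun Delta (Delta a);
  coalgebra_counitl : forall a, tensor_lunit (tensor_map eps idfun (Delta a)) = a;
  coalgebra_counitr : forall a, tensor_runit (tensor_map idfun eps (Delta a)) = a
}.

Record is_algebra : Prop := {
  algebra_assoc : forall t : (A \ox A) \ox A,
    m (tensor_map m idfun t) = m (tensor_map idfun m (tensor_assoc t));
  algebra_unitl : forall t, m (tensor_map eta idfun t) = tensor_lunit t;
  algebra_unitr : forall t, m (tensor_map idfun eta t) = tensor_runit t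
}.

(* The last four clauses say that [Delta] and [eps] are algebra morphisms, the
   algebra A (x) A having product (a (x) b)(c (x) d) = ac (x) bd; note that
   [tensor_lunit] on k (x) k is the multiplication of k. *)
Record is_bialgebra : Prop := {
  bialgebra_coalgebra : is_coalgebra;
  bialgebra_algebra : is_algebra;
  bialgebra_comultM : forall t,
    Delta (m t) = tensor_map m m (tensor_midswap (tensor_map Delta Delta t));
  bialgebra_comult1 : Delta (eta 1) = eta 1 *t eta 1;
  bialgebra_counitM : forall t, eps (m t) = tensor_lunit (tensor_map eps eps t);
  bialgebra_counit1 : eps (eta 1) = 1
}.

End Bialgebra.

Section EndCoalgebra.
Variables (k : fieldType) (V : vectType k).

Definition rank1_fun (beta : 'Hom(V, k^o)) (x y : V) : V := (beta y : k) *: x.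

Lemma rank1_fun_linear beta x : linear (rank1_fun beta x).
Proof. by move=> a y z; rewrite /rank1_fun linearP /= scalerDl scalerA. Qed.

HB.instance Definition _ beta x := GRing.isLinear.Build k V V *:%R
  (rank1_fun beta x) (rank1_fun_linear beta x).

(* beta (x) x, that is y |-> beta(y) x *)
Definition rank1 (beta : 'Hom(V, k^o)) (x : V) : 'End(V) :=
  linfun (rank1_fun beta x).

Lemma rank1E beta x y : rank1 beta x y = (beta y : k) *: x.
Proof. exact: lfunE. Qed.

Lemma rank1_linearr beta : linear (rank1 beta).
Proof.
move=> a x x'; apply/lfunP => y.
by rewrite add_lfunE scale_lfunE !rank1E scalerDr !scalerA mulrC.
Qed.

Definition dual_basis n (X : n.-tuple V) (i : 'I_n) : 'Hom(V, k^o) :=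
  linfun (coord X i : V -> k^o).

Lemma dual_basisE n (X : n.-tuple V) i y : dual_basis X i y = coord X i y.
Proof.
pose c : {linear V -> k^o} := HB.pack (coord X i : V -> k^o)
  (GRing.isLinear.Build k V k^o *:%R (coord X i) (linearP (coord X i))).
exact: (lfunE c y).
Qed.

(* With T = \sum_j x^j (x) T(x_j), the formula of [comultEnd_rank1] below
   extended by linearity; likewise for the counit. *)
Definition comultEnd (T : 'End(V)) : 'End(V) \ox 'End(V) :=
  let X := vbasis {:V} in
  \sum_(j < \dim {:V}) \sum_(i < \dim {:V})
    rank1 (dual_basis X j) X`_i *t rank1 (dual_basis X i) (T X`_j).

Definition counitEnd (T : 'End(V)) : k^o :=
  let X := vbasis {:V} in \sum_(i < \dim {:V}) dual_basis X i (T X`_i).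

Lemma comultEnd_linear : linear comultEnd.
Proof.
move=> a S T; rewrite /comultEnd scaler_sumr -big_split; apply: eq_bigr => j _.
rewrite scaler_sumr -big_split; apply: eq_bigr => i _ /=.
by rewrite add_lfunE scale_lfunE rank1_linearr tmulPr.
Qed.

HB.instance Definition _ := GRing.isLinear.Build k 'End(V) ('End(V) \ox 'End(V))
  *:%R comultEnd comultEnd_linear.

Lemma counitEnd_linear : linear counitEnd.
Proof.
move=> a S T; rewrite /counitEnd scaler_sumr -big_split; apply: eq_bigr => i _.
by rewrite /= add_lfunE scale_lfunE linearP.
Qed.

HB.instance Definition _ := GRing.isLinear.Build k 'End(V) k^o
  *:%R counitEnd counitEnd_linear.

Lemma counitEnd_rank1 beta x : counitEnd (rank1 beta x) = beta x.
Proof.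
rewrite {2}(coord_vbasis (memvf x)) linear_sum; apply: eq_bigr => i _.
rewrite rank1E !linearZ /= dual_basisE; exact: mulrC.
Qed.

Lemma rank1_linearl x : linear (rank1 ^~ x).
Proof.
move=> a b c; apply/lfunP => y.
by rewrite add_lfunE scale_lfunE !rank1E add_lfunE scale_lfunE scalerDl scalerA.
Qed.

Lemma dual_basis_expand n (X : n.-tuple V) (beta : 'Hom(V, k^o)) :
  basis_of {:V} X -> beta = \sum_(i < n) (beta X`_i : k) *: dual_basis X i.
Proof.
move=> bX; apply/lfunP => y.
rewrite {1}(coord_basis bX (memvf y)) linear_sum sum_lfunE; apply: eq_bigr => i _.
rewrite linearZ scale_lfunE dual_basisE /=; exact: mulrC.
Qed.

Lemma rank1Zr c a y : rank1 c (a *: y) = a *: rank1 c y.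
Proof. by apply/lfunP => z; rewrite scale_lfunE !rank1E !scalerA mulrC. Qed.

Lemma rank1_suml n (a : 'I_n -> k) (c : 'I_n -> 'Hom(V, k^o)) y :
  rank1 (\sum_i a i *: c i) y = \sum_i a i *: rank1 (c i) y.
Proof.
pose r : {linear 'Hom(V, k^o) -> 'End(V)} := HB.pack (rank1 ^~ y)
  (GRing.isLinear.Build k _ _ *:%R (rank1 ^~ y) (rank1_linearl y)).
rewrite -[LHS]/(r _) linear_sum; apply: eq_bigr => i _.
by rewrite linearZ.
Qed.

Lemma rank1_sumr n (a : 'I_n -> k) (y : 'I_n -> V) c :
  rank1 c (\sum_i a i *: y i) = \sum_i a i *: rank1 c (y i).
Proof.
pose r : {linear V -> 'End(V)} := HB.pack (rank1 c)
  (GRing.isLinear.Build k _ _ *:%R (rank1 c) (rank1_linearr c)).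
rewrite -[LHS]/(r _) linear_sum; apply: eq_bigr => i _.
by rewrite linearZ.
Qed.

Lemma comultEnd_rank1 n (X : n.-tuple V) beta x : basis_of {:V} X ->
  comultEnd (rank1 beta x) =
  \sum_(i < n) rank1 beta X`_i *t rank1 (dual_basis X i) x.
Proof.
move=> bX; rewrite /comultEnd exchange_big /=; set b := vbasis _.
have bb : basis_of {:V} b by exact: vbasisP.
transitivity (\sum_(i < \dim {:V}) rank1 beta b`_i *t rank1 (dual_basis b i) x).
  apply: eq_bigr => i _.
  rewrite [in RHS](dual_basis_expand beta bb) rank1_suml tmul_suml.
  by apply: eq_bigr => j _; rewrite rank1E rank1Zr tmulZr tmulZl.
transitivity (\sum_(i < \dim {:V}) \sum_(l < n)
    (coord X l b`_i) *: (rank1 beta X`_l *t rank1 (dual_basis b i) x)).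
  apply: eq_bigr => i _.
  rewrite {1}(coord_basis bX (memvf b`_i)) rank1_sumr tmul_suml.
  by apply: eq_bigr => l _; rewrite tmulZl.
rewrite exchange_big /=; apply: eq_bigr => l _.
rewrite [in RHS](dual_basis_expand (dual_basis X l) bb) rank1_suml tmul_sumr.
by apply: eq_bigr => i _; rewrite tmulZr dual_basisE.
Qed.

End EndCoalgebra.

Section LinearCategory.
Variable k : fieldType.

Record linear_category := LinearCategory {
  obj :> Type;
  hom : obj -> obj -> lmodType k;
  idm : forall X, hom X X;
  compm : forall X Y Z, hom Y Z -> hom X Y -> hom X Z;
  comp1m : forall X Y (f : hom X Y), compm (idm Y) f = f;
  compm1 : forall X Y (f : hom X Y), compm f (idm X) = f;
  compmA : forall W X Y Z (h : hom Y Z) (g : hom X Y) (f : hom W X),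
    compm h (compm g f) = compm (compm h g) f;
  compm_bilinear : forall X Y Z, bilinear_for *:%R *:%R (@compm X Y Z)
}.

End LinearCategory.

Notation "g '\oc' f" := (compm g f) (at level 40, left associativity) : ring_scope.

Section Abelian.
Variables (k : fieldType) (C : linear_category k).

Definition is_zero_object (Z : C) : Prop :=
  forall X, (forall f : hom X Z, f = 0) /\ (forall f : hom Z X, f = 0).

Definition is_biproduct (X Y P : C) (iX : hom X P) (iY : hom Y P)
    (pX : hom P X) (pY : hom P Y) : Prop :=
  [/\ pX \oc iX = idm X, pY \oc iY = idm Y, pX \oc iY = 0, pY \oc iX = 0
    & iX \oc pX + iY \oc pY = idm P].

Definition is_kernel (X Y K : C) (f : hom X Y) (i : hom K X) : Prop :=
  f \oc i = 0 /\
  forall (Z : C) (g : hom Z X), f \oc g = 0 -> exists! h : hom Z K, i \oc h = g.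

Definition is_cokernel (X Y Q : C) (f : hom X Y) (p : hom Y Q) : Prop :=
  p \oc f = 0 /\
  forall (Z : C) (g : hom Y Z), g \oc f = 0 -> exists! h : hom Q Z, h \oc p = g.

Definition is_mono (X Y : C) (f : hom X Y) : Prop :=
  forall (Z : C) (g h : hom Z X), f \oc g = f \oc h -> g = h.

Definition is_epi (X Y : C) (f : hom X Y) : Prop :=
  forall (Z : C) (g h : hom Y Z), g \oc f = h \oc f -> g = h.

Record abelian : Prop := {
  abelian_zero : exists Z, is_zero_object Z;
  abelian_biproduct : forall X Y, exists P (iX : hom X P) (iY : hom Y P)
    (pX : hom P X) (pY : hom P Y), is_biproduct iX iY pX pY;
  abelian_kernel : forall X Y (f : hom X Y),
    exists K (i : hom K X), is_kernel f i;
  abelian_cokernel : forall X Y (f : hom X Y),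
    exists Q (p : hom Y Q), is_cokernel f p;
  abelian_normal : forall X Y (f : hom X Y), is_mono f ->
    exists Z (g : hom Y Z), is_kernel g f;
  abelian_conormal : forall X Y (f : hom X Y), is_epi f ->
    exists Z (g : hom Z X), is_cokernel g f
}.

(* The identity of X seen as a morphism X -> Y along an equality of objects. *)
Definition eqm (X Y : C) (e : X = Y) : hom X Y :=
  match e in _ = Z return hom X Z with erefl => idm X end.

(* Strictness: associativity and unitality hold as equalities of objects and of
   morphisms.  The latter equalities are between morphisms whose types only agree
   up to the former, hence the composites with [eqm]. *)
Record strict_monoidal := StrictMonoidal {
  tobj : C -> C -> C;
  tunit : C;
  thom : forall X X' Y Y', hom X X' -> hom Y Y' -> hom (tobj X Y) (tobj X' Y');
  thom1 : forall X Y, thom (idm X) (idm Y) = idm (tobj X Y);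
  thom_comp : forall X X' X'' Y Y' Y'' (f' : hom X' X'') (f : hom X X')
    (g' : hom Y' Y'') (g : hom Y Y'),
    thom (f' \oc f) (g' \oc g) = thom f' g' \oc thom f g;
  tobjA : forall X Y Z, tobj (tobj X Y) Z = tobj X (tobj Y Z);
  tobj1l : forall X, tobj tunit X = X;
  tobj1r : forall X, tobj X tunit = X;
  thomA : forall X X' Y Y' Z Z' (f : hom X X') (g : hom Y Y') (h : hom Z Z'),
    eqm (tobjA X' Y' Z') \oc thom (thom f g) h =
    thom f (thom g h) \oc eqm (tobjA X Y Z);
  thom1l : forall X X' (f : hom X X'),
    eqm (tobj1l X') \oc thom (idm tunit) f = f \oc eqm (tobj1l X);
  thom1r : forall X X' (f : hom X X'),
    eqm (tobj1r X') \oc thom f (idm tunit) = f \oc eqm (tobj1r X)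
}.

Record linear_functor := LinearFunctor {
  fobj :> C -> vectType k;
  fhom : forall X Y, {linear hom X Y -> 'Hom(fobj X, fobj Y)};
  fhom1 : forall X, fhom X X (idm X) = \1%VF;
  fhom_comp : forall X Y Z (g : hom Y Z) (f : hom X Y),
    fhom X Z (g \oc f) = (fhom Y Z g \o fhom X Y f)%VF
}.

End Abelian.

Arguments fhom {k C} F {X Y} : rename.

Definition eqlin (k : fieldType) (V W : vectType k) (e : V = W) : {linear V -> W} :=
  match e in _ = W' return {linear V -> W'} with erefl => idfun end.

Section TensorFunctor.
Variables (k : fieldType) (C : linear_category k) (M : strict_monoidal C).

Local Notation "X '\tc' Y" := (tobj M X Y) (at level 40, left associativity).

Record tensor_functor := TensorFunctor {
  tfunctor :> linear_functor C;
  F2 : forall X Y, {linear tfunctor X \ox tfunctor Y -> tfunctor (X \tc Y)};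
  F2inv : forall X Y, {linear tfunctor (X \tc Y) -> tfunctor X \ox tfunctor Y};
  F2K : forall X Y, cancel (F2 X Y) (F2inv X Y);
  F2invK : forall X Y, cancel (F2inv X Y) (F2 X Y);
  F2_natural : forall X X' Y Y' (f : hom X X') (g : hom Y Y') t,
    fhom tfunctor (thom M f g) (F2 X Y t) =
    F2 X' Y' (tensor_map (fhom tfunctor f) (fhom tfunctor g) t);
  (* F(I) is k itself; [eqlin (esym F_unit)] is the identity k -> F(I). *)
  F_unit : tfunctor (tunit M) = k^o :> vectType k;
  F2_assoc : forall X Y Z t,
    fhom tfunctor (eqm (tobjA M X Y Z)) (F2 (X \tc Y) Z (tensor_map (F2 X Y) idfun t)) =
    F2 X (Y \tc Z) (tensor_map idfun (F2 Y Z) (tensor_assoc t));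
  F2_unitl : forall X t,
    fhom tfunctor (eqm (tobj1l M X))
      (F2 (tunit M) X (tensor_map (eqlin (esym F_unit)) idfun t)) = tensor_lunit t;
  F2_unitr : forall X t,
    fhom tfunctor (eqm (tobj1r M X))
      (F2 X (tunit M) (tensor_map idfun (eqlin (esym F_unit)) t)) = tensor_runit t
}.

End TensorFunctor.

Section Coend.
Variables (k : fieldType) (C : linear_category k) (F : linear_functor C).

Definition dinatural (W : lmodType k)
    (i : forall X : C, {linear 'End(F X) -> W}) : Prop :=
  forall (X Y : C) (f : hom Y X) (T : 'Hom(F X, F Y)),
    i X (fhom F f \o T)%VF = i Y (T \o fhom F f)%VF.

Record coend := Coend {
  coend_sort :> lmodType k;
  coend_inj : forall X : C, {linear 'End(F X) -> coend_sort};
  coend_dinatural : dinatural coend_inj;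
  coend_universal : forall (W : lmodType k)
    (j : forall X : C, {linear 'End(F X) -> W}), dinatural j ->
    exists phi : {linear coend_sort -> W},
      (forall X T, phi (coend_inj X T) = j X T) /\
      (forall psi : {linear coend_sort -> W},
        (forall X T, psi (coend_inj X T) = j X T) -> psi =1 phi)
}.

End Coend.

Section CoendStructure.
Variables (k : fieldType) (C : linear_category k) (M : strict_monoidal C).
Variables (F : tensor_functor M) (E : coend F).

Definition is_coend_comult (Delta : {linear E -> E \ox E}) : Prop :=
  forall (X : C) (T : 'End(F X)),
    Delta (coend_inj E X T) =
    tensor_map (coend_inj E X) (coend_inj E X) (comultEnd T).

Definition is_coend_counit (eps : {linear E -> k^o}) : Prop :=
  forall (X : C) (T : 'End(F X)), eps (coend_inj E X T) = counitEnd T.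

Definition conj_F2 (X Y : C) (S : 'End(F X)) (T : 'End(F Y)) :
    'End(F (tobj M X Y)) :=
  linfun (F2 F X Y \o tensor_map S T \o F2inv F X Y).

Definition is_coend_mult (m : {linear E \ox E -> E}) : Prop :=
  forall (X Y : C) (S : 'End(F X)) (T : 'End(F Y)),
    m (coend_inj E X S *t coend_inj E Y T) =
    coend_inj E (tobj M X Y) (conj_F2 S T).

(* i_I precomposed with the identification a |-> a * id of k with
   Hom(F(I), F(I)) *)
Definition coend_unit (a : k^o) : E := coend_inj E (tunit M) ((a : k) *: \1%VF).

Lemma coend_unit_linear : linear coend_unit.
Proof. by move=> a b c; rewrite /coend_unit scalerDl -scalerA linearP. Qed.

HB.instance Definition _ := GRing.isLinear.Build k k^o E *:%R
  coend_unit coend_unit_linear.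

End CoendStructure.

Definition unique_linear (k : fieldType) (U V : lmodType k)
    (P : {linear U -> V} -> Prop) (f : {linear U -> V}) : Prop :=
  P f /\ forall g, P g -> g =1 f.

(* Main.v *)
From HB Require Import structures.
From mathcomp Require Import all_boot all_order all_algebra.
From mathcomp Require Import sesquilinear boolp functions.
Require Import Defs.

Set Implicit Arguments.
Unset Strict Implicit.
Unset Printing Implicit Defensive.

Import GRing.Theory.
Local Open Scope ring_scope.

(** The coend is spanned by the elements i_X(T), and since End(F X) is spanned
    by its rank one maps, already by the elements i_X(beta (x) x).  A linear map
    out of a tensor power of the coend is thus determined by its values on
    tensors of such elements, and every axiom becomes an explicit identity
    between them.

    The coalgebra part rests on one fact about V (x) V^*: a sum of u_a (x) c_a
    depends only on the endomorphism v |-> \sum c_a(v) u_a ([resolution_sum]).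
    When this endomorphism is the identity, (u, c) is called a resolution of
    the identity.  Any resolution may replace a basis and its dual in the
    formula of Delta_X ([comult_injE]).  The same fact for maps
    V -> W gives the dinaturality of Delta_X: for f : F Y -> F X, the families
    (x_i, x^i f) and (f y_j, y^j) both represent f.

    The product exists by using the universal property twice: for fixed S in
    End(F X), the map T |-> i_{X (x) Y}(F_2 (S (x) T) F_2^-1) is dinatural in Y
    and induces a map phi_S from the coend to itself; then S |-> phi_S is
    dinatural in X, with values in the space of functions from the coend to
    itself ([coend_mult_exists]).  Both follow from the naturality of F_2.

    The product of i_X(beta (x) x) and i_Y(gamma (x) y) is again of rank one:
    it comes from the form (beta (x) gamma) F_2^-1 and the vector F_2(x (x) y).
    Hence the counit is multiplicative, and since the vectors F_2(x_i (x) y_j)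
    with the forms (x^i (x) y^j) F_2^-1 resolve the identity of F(X (x) Y)
    ([F2_resolution]), so is the comultiplication.  At the unit object, F(I) = k
    is a line, resolved by the single vector 1, which makes i_I(id) grouplike.
    Finally associativity and unitality of the product are dinaturality of i
    along the identity morphisms eqm of the strict structure
    ([coend_inj_eqm]), which F_2 turns into the associativity and unit
    isomorphisms of vector spaces. *)

(** * Spanning families and linear maps out of tensor products *)

Section Spanning.
Variable k : fieldType.

(** Spanning is expressed through its consequence for linear maps, the form in
    which the uniqueness half of a universal property provides it. *)
Definition spanning (A : lmodType k) (G : A -> Prop) : Prop :=
  forall (Z : lmodType k) (f g : {linear A -> Z}),
    (forall a, G a -> f a = g a) -> f =1 g.

Lemma spanning_tensor (A B : lmodType k) (G : A -> Prop) (H : B -> Prop) :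
  spanning G -> spanning H ->
  spanning (fun t : A \ox B => exists a b, [/\ G a, H b & t = a *t b]).
Proof.
move=> sG sH Z f g fg; apply: tensor_ext => u v.
(* h as a linear map of each of its two arguments. *)
pose tr (h : {linear A \ox B -> Z}) a : {linear B -> Z} :=
  HB.pack (fun b => h (a *t b)) (GRing.isLinear.Build k B Z *:%R
    (fun b => h (a *t b)) (fun c b b' => etrans (congr1 h (tmulPr c a b b'))
                                           (linearP h c _ _))).
pose tl (h : {linear A \ox B -> Z}) b : {linear A -> Z} :=
  HB.pack (fun a => h (a *t b)) (GRing.isLinear.Build k A Z *:%R
    (fun a => h (a *t b)) (fun c a a' => etrans (congr1 h (tmulPl c a a' b))
                                           (linearP h c _ _))).
apply: (sH _ (tr f u) (tr g u)) => b Hb /=.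
apply: (sG _ (tl f b) (tl g b)) => a Ga /=.
by apply: fg; exists a, b.
Qed.

Lemma spanning_regular : spanning (fun a : k^o => a = 1).
Proof.
move=> Z f g fg a.
by rewrite -[a]mulr1 -[a * 1]/(a *: (1 : k^o)) !linearZ fg.
Qed.

Lemma tensor_uncurry (A B Z : lmodType k) (h : A -> B -> Z) :
  (forall b, linear (h^~ b)) -> (forall a, linear (h a)) ->
  exists m : {linear A \ox B -> Z}, forall a b, m (a *t b) = h a b.
Proof.
move=> hl hr.
pose bl : {bilinear A -> B -> Z} :=
  HB.pack h (bilinear_isBilinear.Build k A B Z *:%R *:%R h (conj hl hr)).
by exists (tensor_lift bl) => a b; exact: (tensor_liftE bl).
Qed.

End Spanning.

(** * Rank one maps and resolutions of a linear map *)

Section Rank1.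
Variables (k : fieldType) (V W : vectType k).

Definition scaleby (y : W) (a : k^o) : W := (a : k) *: y.

Lemma scaleby_linear y : linear (scaleby y).
Proof. by move=> c a b; rewrite /scaleby scalerDl scalerA. Qed.

HB.instance Definition _ y := GRing.isLinear.Build k k^o W *:%R
  (scaleby y) (scaleby_linear y).

(** Dinaturality involves maps between the spaces of two objects, so the rank
    one maps beta (x) y are needed between two different spaces. *)
Definition rank1_hom (beta : 'Hom(V, k^o)) (y : W) : 'Hom(V, W) :=
  (linfun (scaleby y) \o beta)%VF.

Lemma rank1_homE beta y x : rank1_hom beta y x = (beta x : k) *: y.
Proof. by rewrite comp_lfunE lfunE. Qed.

Lemma rank1_hom_linearr beta : linear (rank1_hom beta).
Proof.
move=> a x x'; apply/lfunP => y.
by rewrite add_lfunE scale_lfunE !rank1_homE scalerDr !scalerA mulrC.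
Qed.

HB.instance Definition _ beta := GRing.isLinear.Build k W 'Hom(V, W) *:%R
  (rank1_hom beta) (rank1_hom_linearr beta).

(** [rank1_hom] with its arguments exchanged: a head symbol that can carry the
    linearity in the form. *)
Definition rank1_form (y : W) (beta : 'Hom(V, k^o)) : 'Hom(V, W) :=
  rank1_hom beta y.

Lemma rank1_form_linear y : linear (rank1_form y).
Proof.
move=> a b c; apply/lfunP => z.
rewrite add_lfunE scale_lfunE !rank1_homE add_lfunE scale_lfunE.
by rewrite scalerDl scalerA.
Qed.

HB.instance Definition _ y := GRing.isLinear.Build k 'Hom(V, k^o) 'Hom(V, W)
  *:%R (rank1_form y) (rank1_form_linear y).

Lemma spanning_rank1 :
  spanning (fun T : 'Hom(V, W) => exists beta y, T = rank1_hom beta y).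
Proof.
move=> Z f g fg T; pose X := vbasis {:V}.
have -> : T = \sum_i rank1_hom (dual_basis X i) (T X`_i).
  apply/lfunP => x; rewrite {1}(coord_vbasis (memvf x)) linear_sum sum_lfunE.
  by apply: eq_bigr => i _; rewrite rank1_homE dual_basisE linearZ.
rewrite !linear_sum; apply: eq_bigr => i _; apply: fg.
by exists (dual_basis X i), (T X`_i).
Qed.

(** The left-hand side is A (x) D applied to the tensor \sum u_a (x) c_a, and
    W (x) V^* embeds into Hom(V, W); so only the map f represented by the
    families matters.  The proof expands each c_a in the dual basis and then
    gathers the u_a into f(x_i). *)
Lemma resolution_sum (P Q : lmodType k) (A : {linear W -> P})
    (D : {linear 'Hom(V, k^o) -> Q}) (f : V -> W)
    (I : finType) (u : I -> W) (c : I -> 'Hom(V, k^o)) :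
  (forall v, \sum_a (c a v : k) *: u a = f v) ->
  \sum_a A (u a) *t D (c a) =
  \sum_(i < \dim {:V}) A (f (vbasis {:V})`_i) *t D (dual_basis (vbasis {:V}) i).
Proof.
move=> uc; set X := vbasis _.
have bX : basis_of {:V} X by exact: vbasisP.
transitivity (\sum_a \sum_(i < \dim {:V})
    (c a X`_i : k) *: (A (u a) *t D (dual_basis X i))).
  apply: eq_bigr => a _; rewrite {1}(dual_basis_expand (c a) bX).
  rewrite linear_sum linear_sumr; apply: eq_bigr => i _.
  by rewrite [D _]linearZ /= tmulZr.
rewrite exchange_big; apply: eq_bigr => i _ /=.
rewrite -uc linear_sum linear_sumlz; apply: eq_bigr => a _.
by rewrite [A (_ *: _)]linearZ /= tmulZl.
Qed.

End Rank1.

Lemma comp_rank1_hom (k : fieldType) (U V W : vectType k) (f : 'Hom(V, W))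
    (beta : 'Hom(U, k^o)) y :
  (f \o rank1_hom beta y)%VF = rank1_hom beta (f y).
Proof. by apply/lfunP => x; rewrite comp_lfunE !rank1_homE linearZ. Qed.

Lemma rank1_hom_comp (k : fieldType) (U V W : vectType k) (f : 'Hom(U, V))
    (beta : 'Hom(V, k^o)) (y : W) :
  (rank1_hom beta y \o f)%VF = rank1_hom (beta \o f) y.
Proof. by apply/lfunP => x; rewrite comp_lfunE !rank1_homE comp_lfunE. Qed.

Lemma rank1_homEnd (k : fieldType) (V : vectType k) (beta : 'Hom(V, k^o)) x :
  rank1_hom beta x = rank1 beta x.
Proof. by apply/lfunP => y; rewrite rank1_homE rank1E. Qed.

(** On a space that is equal to k, the element corresponding to 1 and the
    identity form resolve the identity. *)
Lemma line_resolution (k : fieldType) (V : vectType k)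
    (p : V = k^o :> vectType k) :
  exists e : 'Hom(V, k^o), e (eqlin (esym p) 1) = 1 /\
    forall v, (e v : k) *: eqlin (esym p) 1 = v.
Proof.
move: (esym p) => {p} q; case: _ / q => /=.
exists \1%VF; split=> [|v]; rewrite lfunE //=; exact: mulr1.
Qed.

(** * The coalgebra structure of the coend *)

Section CoendCoalgebra.
Variables (k : fieldType) (C : linear_category k) (F : linear_functor C).
Variable E : coend F.
Local Notation i := (coend_inj E).

(** Two linear maps that agree on the images of the i_X both factor the same
    dinatural family. *)
Lemma spanning_coend : spanning (fun a : E => exists X T, a = i X T).
Proof.
move=> Z f g fg.
have dg : dinatural (fun X => g \o i X : {linear _ -> _}).
  by move=> X Y h T /=; rewrite coend_dinatural.
have [phi [_ uniq]] := coend_universal E dg.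
move=> a; rewrite (uniq g) //; apply: uniq => X T /=.
by apply: fg; exists X, T.
Qed.

Lemma spanning_coend_rank1 :
  spanning (fun a : E => exists X beta x, a = i X (rank1_hom beta x)).
Proof.
move=> Z f g fg; apply: spanning_coend => _ [X [T ->]].
apply: (spanning_rank1 (f := f \o i X) (g := g \o i X)) => _ [beta [x ->]] /=.
by apply: fg; exists X, beta, x.
Qed.

(** Both sides of the dinaturality equation are linear in T; for T = beta (x) y
    they are the maps at beta (x) f y and at (beta f) (x) y. *)
Lemma dinatural_rank1 (Z : lmodType k)
    (j : forall X : C, {linear 'End(F X) -> Z}) :
  (forall (X Y : C) (f : hom Y X) beta y,
    j X (rank1_hom beta (fhom F f y)) =
    j Y (rank1_hom (beta \o fhom F f)%VF y)) ->
  dinatural j.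
Proof.
move=> jP X Y f T; move: T.
pose l (T : 'Hom(F X, F Y)) := j X (fhom F f \o T)%VF.
pose r (T : 'Hom(F X, F Y)) := j Y (T \o fhom F f)%VF.
have ll : linear l by move=> a S T; rewrite /l comp_lfunDr -comp_lfunZr linearP.
have rl : linear r by move=> a S T; rewrite /r comp_lfunDl -comp_lfunZl linearP.
pose l' : {linear _ -> _} := HB.pack l (GRing.isLinear.Build k _ _ *:%R l ll).
pose r' : {linear _ -> _} := HB.pack r (GRing.isLinear.Build k _ _ *:%R r rl).
apply: (spanning_rank1 (f := l') (g := r')) => _ [beta [y ->]].
by rewrite /= /l /r comp_rank1_hom rank1_hom_comp.
Qed.

Lemma coend_slide (X Y : C) (f : hom Y X) beta y :
  i X (rank1_hom beta (fhom F f y)) = i Y (rank1_hom (beta \o fhom F f)%VF y).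
Proof. by rewrite -comp_rank1_hom -rank1_hom_comp coend_dinatural. Qed.

Definition comult_inj (X : C) : {linear 'End(F X) -> E \ox E} :=
  tensor_map (i X) (i X) \o @comultEnd k (F X).

(** The comultiplication of End(F X) may be computed with any resolution of the
    identity in place of a basis: this is what evaluates it on F(X (x) Y). *)
Lemma comult_injE (X : C) beta x (I : finType) (u : I -> F X)
    (c : I -> 'Hom(F X, k^o)) :
  (forall v, \sum_a (c a v : k) *: u a = v) ->
  comult_inj X (rank1_hom beta x) =
  \sum_a i X (rank1_hom beta (u a)) *t i X (rank1_hom (c a) x).
Proof.
move=> uc.
have -> := resolution_sum (i X \o rank1_hom beta) (i X \o rank1_form x) uc.
rewrite /= rank1_homEnd (comultEnd_rank1 _ _ (vbasisP {:F X})) linear_sum.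
by apply: eq_bigr => j _; rewrite /= tensor_mapE -!rank1_homEnd.
Qed.

Lemma vbasis_resolution (X : C) (v : F X) :
  \sum_j (dual_basis (vbasis {:F X}) j v : k) *: (vbasis {:F X})`_j = v.
Proof.
rewrite [RHS](coord_vbasis (memvf v)).
by apply: eq_bigr => j _; rewrite dual_basisE.
Qed.

(** Sliding f through one tensor factor turns the two sides into sums over the
    families (x_i, x^i f) and (f y_j, y^j).  Both represent f, so the sums
    agree by [resolution_sum]. *)
Lemma comult_inj_dinatural : dinatural comult_inj.
Proof.
apply: dinatural_rank1 => X Y f beta y.
rewrite !(comult_injE _ _ (@vbasis_resolution _)).
set BX := vbasis {:F X}; set BY := vbasis {:F Y}.
transitivity (\sum_(j < \dim {:F X}) i X (rank1_hom beta BX`_j) *t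
                     i Y (rank1_hom (dual_basis BX j \o fhom F f)%VF y)).
  by apply: eq_bigr => j _; rewrite coend_slide.
have fX v : \sum_(j < \dim {:F X})
    ((dual_basis BX j \o fhom F f)%VF v : k) *: BX`_j = fhom F f v.
  by rewrite -[RHS]vbasis_resolution; apply: eq_bigr => j _; rewrite comp_lfunE.
rewrite (resolution_sum (i X \o rank1_hom beta) (i Y \o rank1_form y) fX) /=.
by apply: eq_bigr => j _; rewrite coend_slide.
Qed.

Lemma counit_dinatural :
  dinatural (fun X => @counitEnd k (F X) : {linear _ -> _}).
Proof.
apply: dinatural_rank1 => X Y f beta y /=.
by rewrite !rank1_homEnd !counitEnd_rank1 comp_lfunE.
Qed.

Section Coalgebra.
Variables (Delta : {linear E -> E \ox E}) (eps : {linear E -> k^o}).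
Hypothesis DeltaP : forall X T, Delta (i X T) = comult_inj X T.
Hypothesis epsP : forall X T, eps (i X T) = counitEnd T.

Lemma comultE (X : C) beta x (I : finType) (u : I -> F X)
    (c : I -> 'Hom(F X, k^o)) :
  (forall v, \sum_a (c a v : k) *: u a = v) ->
  Delta (i X (rank1_hom beta x)) =
  \sum_a i X (rank1_hom beta (u a)) *t i X (rank1_hom (c a) x).
Proof. by move=> uc; rewrite DeltaP; apply: (comult_injE _ _ uc). Qed.

Lemma counitE (X : C) beta x : eps (i X (rank1_hom beta x)) = beta x.
Proof. by rewrite epsP rank1_homEnd counitEnd_rank1. Qed.

Lemma coend_coalgebra : is_coalgebra Delta eps.
Proof.
split.
- apply: (spanning_coend_rank1
      (f := tensor_assoc \o tensor_map Delta idfun \o Delta)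
      (g := tensor_map idfun Delta \o Delta)) => _ [X [beta [x ->]]] /=.
  have vb := @vbasis_resolution X; rewrite (comultE _ _ vb) !linear_sum /=.
  under eq_bigr do
    rewrite tensor_mapE (comultE _ _ vb) /= linear_sumlz linear_sum /=.
  under [RHS]eq_bigr do rewrite tensor_mapE (comultE _ _ vb) /= linear_sumr /=.
  rewrite exchange_big; apply: eq_bigr => a _; apply: eq_bigr => b _ /=.
  by rewrite tensor_assocE.
- apply: (spanning_coend_rank1
      (f := tensor_lunit \o tensor_map eps idfun \o Delta)
      (g := idfun)) => _ [X [beta [x ->]]] /=.
  have vb := @vbasis_resolution X; rewrite (comultE _ _ vb) !linear_sum /=.
  rewrite {2}(dual_basis_expand beta (vbasisP _)) -/(rank1_form x _) !linear_sum.
  apply: eq_bigr => a _.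
  by rewrite tensor_mapE tensor_lunitE counitE !linearZ.
apply: (spanning_coend_rank1
    (f := tensor_runit \o tensor_map idfun eps \o Delta)
    (g := idfun)) => _ [X [beta [x ->]]] /=.
have vb := @vbasis_resolution X; rewrite (comultE _ _ vb) !linear_sum /=.
rewrite -{2}(vb x) !linear_sum; apply: eq_bigr => a _.
by rewrite tensor_mapE tensor_runitE counitE !linearZ.
Qed.

End Coalgebra.
End CoendCoalgebra.

(** * Tensor products of linear maps seen through F_2 *)

Section TensorHom.
Variables (k : fieldType) (C : linear_category k) (M : strict_monoidal C).
Variable F : tensor_functor M.

Local Notation "X '\tc' Y" := (tobj M X Y) (at level 40, left associativity).

(** [conj_F2] for maps between different objects, needed to factor morphisms of
    the category out of S and T separately. *)
Definition F2_hom (X X' Y Y' : C) (S : 'Hom(F X, F X')) (T : 'Hom(F Y, F Y')) :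
    'Hom(F (X \tc Y), F (X' \tc Y')) :=
  linfun (F2 F X' Y' \o tensor_map S T \o F2inv F X Y).

Lemma F2_homE (X X' Y Y' : C) (S : 'Hom(F X, F X')) (T : 'Hom(F Y, F Y')) x y :
  F2_hom S T (F2 F X Y (x *t y)) = F2 F X' Y' (S x *t T y).
Proof. by rewrite lfunE /= F2K tensor_mapE. Qed.

Lemma F2_hom_ext (X Y : C) (W : vectType k) (f g : 'Hom(F (X \tc Y), W)) :
  (forall x y, f (F2 F X Y (x *t y)) = g (F2 F X Y (x *t y))) -> f = g.
Proof.
move=> fg; apply/lfunP => v; rewrite -(F2invK v).
exact: (tensor_ext (f := f \o F2 F X Y) (g := g \o F2 F X Y)).
Qed.

Lemma F2_hom_ext3 (X Y Z : C) (W : vectType k)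
    (f g : 'Hom(F ((X \tc Y) \tc Z), W)) :
  (forall x y z, f (F2 F _ Z (F2 F X Y (x *t y) *t z)) =
                 g (F2 F _ Z (F2 F X Y (x *t y) *t z))) -> f = g.
Proof.
move=> fg; apply: F2_hom_ext => v z; rewrite -(F2invK v).
elim/tensor_ind: {v}(F2inv F X Y v) => [x y|s t hs ht]; first exact: fg.
by rewrite linearD linearDl !linearD /= hs ht.
Qed.

Lemma F2_natE (X X' Y Y' : C) (f : hom X X') (g : hom Y Y') x y :
  fhom F (thom M f g) (F2 F X Y (x *t y)) =
  F2 F X' Y' (fhom F f x *t fhom F g y).
Proof. by rewrite F2_natural tensor_mapE. Qed.

Lemma F2_hom_linearl (X X' Y Y' : C) (T : 'Hom(F Y, F Y')) :
  linear ((@F2_hom X X' Y Y')^~ T).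
Proof.
move=> a S S'; apply: F2_hom_ext => x y; rewrite add_lfunE scale_lfunE !F2_homE.
by rewrite add_lfunE scale_lfunE tmulPl linearP.
Qed.

Lemma F2_hom_linearr (X X' Y Y' : C) (S : 'Hom(F X, F X')) :
  linear (@F2_hom X X' Y Y' S).
Proof.
move=> a T T'; apply: F2_hom_ext => x y; rewrite add_lfunE scale_lfunE !F2_homE.
by rewrite add_lfunE scale_lfunE tmulPr linearP.
Qed.

Lemma F2_hom_compl (X X' X'' Y Y' Y'' : C) (f : hom X' X'') (g : hom Y' Y'')
    (S : 'Hom(F X, F X')) (T : 'Hom(F Y, F Y')) :
  (fhom F (thom M f g) \o F2_hom S T)%VF =
  F2_hom (fhom F f \o S)%VF (fhom F g \o T)%VF.
Proof.
by apply: F2_hom_ext => x y; rewrite comp_lfunE !F2_homE F2_natE !comp_lfunE.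
Qed.

Lemma F2_hom_compr (X X' X'' Y Y' Y'' : C) (f : hom X X') (g : hom Y Y')
    (S : 'Hom(F X', F X'')) (T : 'Hom(F Y', F Y'')) :
  (F2_hom S T \o fhom F (thom M f g))%VF =
  F2_hom (S \o fhom F f)%VF (T \o fhom F g)%VF.
Proof.
by apply: F2_hom_ext => x y; rewrite comp_lfunE F2_natE !F2_homE !comp_lfunE.
Qed.

Lemma conj_F2E (X Y : C) (S : 'End(F X)) (T : 'End(F Y)) x y :
  conj_F2 S T (F2 F X Y (x *t y)) = F2 F X Y (S x *t T y).
Proof. exact: F2_homE. Qed.

(** The form on F(X (x) Y) that corresponds to beta (x) gamma. *)
Definition F2_form (X Y : C) (beta : 'Hom(F X, k^o)) (gamma : 'Hom(F Y, k^o)) :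
    'Hom(F (X \tc Y), k^o) :=
  linfun (tensor_lunit \o tensor_map beta gamma \o F2inv F X Y).

Lemma F2_formE (X Y : C) (beta : 'Hom(F X, k^o)) (gamma : 'Hom(F Y, k^o)) x y :
  F2_form beta gamma (F2 F X Y (x *t y)) = beta x * gamma y.
Proof. by rewrite lfunE /= F2K tensor_mapE tensor_lunitE. Qed.

Lemma conj_F2_rank1 (X Y : C) (beta : 'Hom(F X, k^o)) x
    (gamma : 'Hom(F Y, k^o)) y :
  conj_F2 (rank1_hom beta x) (rank1_hom gamma y) =
  rank1_hom (F2_form beta gamma) (F2 F X Y (x *t y)).
Proof.
apply: F2_hom_ext => x' y'; rewrite conj_F2E !rank1_homE F2_formE.
by rewrite tmulZl tmulZr !linearZ /= scalerA.
Qed.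

(** After F_2^-1 this is the tensor product of two resolutions, checked on pure
    tensors as an equality of endomorphisms. *)
Lemma F2_resolution (X Y : C) (I J : finType) (u : I -> F X)
    (b : I -> 'Hom(F X, k^o)) (v : J -> F Y) (c : J -> 'Hom(F Y, k^o)) :
  (forall x, \sum_p (b p x : k) *: u p = x) ->
  (forall y, \sum_q (c q y : k) *: v q = y) ->
  forall w, \sum_(a : I * J) (F2_form (b a.1) (c a.2) w : k) *:
    F2 F X Y (u a.1 *t v a.2) = w.
Proof.
move=> ub vc w.
suff : (\sum_(a : I * J) rank1_hom (F2_form (b a.1) (c a.2))
          (F2 F X Y (u a.1 *t v a.2)) = \1)%VF.
  move/lfunP/(_ w); rewrite sum_lfunE id_lfunE => {2}<-.
  by apply: eq_bigr => a _; rewrite rank1_homE.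
apply: F2_hom_ext => x y; rewrite sum_lfunE id_lfunE.
rewrite -{2}(ub x) -{2}(vc y) linear_sumlz linear_sum /=.
under [RHS]eq_bigr do rewrite linear_sumr linear_sum.
rewrite pair_big /=; apply: eq_bigr => a _.
by rewrite rank1_homE F2_formE tmulZl tmulZr !linearZ /= scalerA.
Qed.

End TensorHom.

(** * The product of the coend *)

Section CoendProduct.
Variables (k : fieldType) (C : linear_category k) (M : strict_monoidal C).
Variables (F : tensor_functor M) (E : coend F).
Local Notation i := (coend_inj E).
Local Notation "X '\tc' Y" := (tobj M X Y) (at level 40, left associativity).

Lemma conj_F2_dinaturalr (X Y Y' : C) (S : 'End(F X)) (f : hom Y' Y)
    (T : 'Hom(F Y, F Y')) :
  i (X \tc Y) (conj_F2 S (fhom F f \o T)%VF) =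
  i (X \tc Y') (conj_F2 S (T \o fhom F f)%VF).
Proof.
transitivity (i (X \tc Y) (fhom F (thom M (idm X) f) \o F2_hom S T)%VF).
  by rewrite F2_hom_compl fhom1 comp_lfun1l.
by rewrite coend_dinatural F2_hom_compr fhom1 comp_lfun1r.
Qed.

Lemma conj_F2_dinaturall (X X' Y : C) (T : 'End(F Y)) (f : hom X' X)
    (S : 'Hom(F X, F X')) :
  i (X \tc Y) (conj_F2 (fhom F f \o S)%VF T) =
  i (X' \tc Y) (conj_F2 (S \o fhom F f)%VF T).
Proof.
transitivity (i (X \tc Y) (fhom F (thom M f (idm Y)) \o F2_hom S T)%VF).
  by rewrite F2_hom_compl fhom1 comp_lfun1l.
by rewrite coend_dinatural F2_hom_compr fhom1 comp_lfun1r.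
Qed.

Lemma coend_mult_left (X : C) (S : 'End(F X)) :
  exists phi : {linear E -> E},
    forall (Y : C) (T : 'End(F Y)), phi (i Y T) = i (X \tc Y) (conj_F2 S T).
Proof.
pose j Y (T : 'End(F Y)) := i (X \tc Y) (conj_F2 S T).
have jl Y : linear (j Y).
  by move=> a T T'; rewrite /j -linearP; congr (i _ _); apply: F2_hom_linearr.
pose j' Y : {linear _ -> _} := HB.pack (j Y)
  (GRing.isLinear.Build k _ _ *:%R (j Y) (jl Y)).
have dj : dinatural j' by move=> Y Y' f T; apply: conj_F2_dinaturalr.
by have [phi [phiE _]] := coend_universal E dj; exists phi => Y T; rewrite phiE.
Qed.

(** The universal property needs a vector space as target, and all functions
    from the coend to itself form one; that the resulting Phi(u) is linear for
    every u is then checked on the spanning elements u = i_X(S). *)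
Lemma coend_mult_exists : exists m : {linear E \ox E -> E}, is_coend_mult m.
Proof.
(* The universal property only asserts that a map exists for each S; choosing
   one makes it a function of S. *)
pose phi X S := sval (cid (coend_mult_left (X := X) S)).
have phiE X S Y T : phi X S (i Y T) = i (X \tc Y) (conj_F2 S T).
  exact: (svalP (cid (coend_mult_left (X := X) S))).
pose j X (S : 'End(F X)) : E -> E := phi X S.
have jl X : linear (j X).
  move=> a S S'; apply/funext => b; rewrite !fctE; move: b.
  apply: (spanning_coend (f := phi X (a *: S + S'))
    (g := a \*: phi X S \+ phi X S')) => _ [Y [T ->]] /=.
  rewrite !phiE -linearP; congr (i _ _); exact: F2_hom_linearl.
pose j' X : {linear 'End(F X) -> (E -> E)} := HB.pack (j X)
  (GRing.isLinear.Build k _ _ *:%R (j X) (jl X)).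
have dj : dinatural j'.
  move=> X X' f S; apply/funext.
  apply: (spanning_coend (f := phi X _) (g := phi X' _)) => _ [Y [T ->]].
  by rewrite !phiE conj_F2_dinaturall.
have [Phi [PhiE _]] := coend_universal E dj.
have Phil b : linear (Phi^~ b) by move=> a u v; rewrite linearP !fctE.
have Phir u : linear (Phi u).
  move=> a b c; move: u.
  pose l d : {linear E -> E} := HB.pack (Phi^~ d)
    (GRing.isLinear.Build k E E *:%R (Phi^~ d) (Phil d)).
  apply: (spanning_coend (f := l (a *: b + c))
    (g := a \*: l b \+ l c)) => _ [X [S ->]] /=.
  by rewrite PhiE /j' /= /j linearP.
have [m mE] := tensor_uncurry Phil Phir.
by exists m => X Y S T; rewrite mE PhiE /= /j phiE.
Qed.

(** Dinaturality along an isomorphism identifies conjugate endomorphisms; for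
    an identity morphism between equal objects it is enough to treat the case
    where the objects coincide. *)
Lemma coend_inj_eqm (X Y : C) (p : X = Y) (S : 'End(F X)) (T : 'End(F Y)) :
  (fhom F (eqm p) \o S = T \o fhom F (eqm p))%VF -> i X S = i Y T.
Proof.
case: _ / p T => T; rewrite /= fhom1 comp_lfun1l comp_lfun1r.
by move=> ->.
Qed.

(** * The bialgebra axioms *)

Section Algebra.
Variable m : {linear E \ox E -> E}.
Hypothesis mP : is_coend_mult m.

Let eta : {linear k^o -> E} := coend_unit E.

Let one := eqlin (esym (F_unit F)) 1.

Lemma eta1 : eta 1 = i (tunit M) \1%VF.
Proof. by rewrite /eta /= /coend_unit scale1r. Qed.

(** Both products come from the same map of F X (x) F Y (x) F Z, transported to
    the two bracketings; the compatibility of F_2 with associativity says that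
    the identity morphism between them intertwines the two. *)
Lemma coend_mult_assoc (t : (E \ox E) \ox E) :
  m (tensor_map m idfun t) = m (tensor_map idfun m (tensor_assoc t)).
Proof.
have sE := spanning_coend (E := E).
move: t; apply: (spanning_tensor (spanning_tensor sE sE) sE
  (f := m \o tensor_map m idfun) (g := m \o tensor_map idfun m \o tensor_assoc)).
move=> _ [_ [_ [[_ [_ [[X [S ->]] [Y [T ->]] ->]]] [Z [U ->]] ->]]] /=.
rewrite tensor_assocE !tensor_mapE /= !mP.
apply: (coend_inj_eqm (p := tobjA M X Y Z)); apply: F2_hom_ext3 => x y z.
have aE x' y' z' : fhom F (eqm (tobjA M X Y Z))
    (F2 F (X \tc Y) Z (F2 F X Y (x' *t y') *t z')) =
    F2 F X (Y \tc Z) (x' *t F2 F Y Z (y' *t z')).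
  have := F2_assoc ((x' *t y') *t z').
  by rewrite tensor_assocE !tensor_mapE.
by rewrite !comp_lfunE !conj_F2E !aE !conj_F2E.
Qed.

Lemma coend_mult_unitl (t : k^o \ox E) :
  m (tensor_map eta idfun t) = tensor_lunit t.
Proof.
move: t; apply: (spanning_tensor (@spanning_regular k)
  (spanning_coend (E := E)) (f := m \o tensor_map eta idfun) (g := tensor_lunit)).
move=> _ [_ [_ [-> [X [T ->]] ->]]] /=.
rewrite tensor_mapE tensor_lunitE scale1r eta1 mP.
apply: (coend_inj_eqm (p := tobj1l M X)); apply: F2_hom_ext => v x.
have [e [_ eP]] := line_resolution (F_unit F).
(* On 1 (x) x', the compatibility of F_2 with the unit returns x'. *)
have lE x' : fhom F (eqm (tobj1l M X)) (F2 F _ X (one *t x')) = x'.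
  by have := F2_unitl (1 *t x'); rewrite tensor_mapE tensor_lunitE scale1r.
rewrite !comp_lfunE conj_F2E id_lfunE -(eP v) !tmulZl !linearZ /=.
by rewrite !lE.
Qed.

Lemma coend_mult_unitr (t : E \ox k^o) :
  m (tensor_map idfun eta t) = tensor_runit t.
Proof.
move: t; apply: (spanning_tensor (spanning_coend (E := E)) (@spanning_regular k)
  (f := m \o tensor_map idfun eta) (g := tensor_runit)).
move=> _ [_ [_ [[X [T ->]] -> ->]]] /=.
rewrite tensor_mapE tensor_runitE scale1r eta1 mP.
apply: (coend_inj_eqm (p := tobj1r M X)); apply: F2_hom_ext => x v.
have [e [_ eP]] := line_resolution (F_unit F).
have rE x' : fhom F (eqm (tobj1r M X)) (F2 F X _ (x' *t one)) = x'.
  by have := F2_unitr (x' *t 1); rewrite tensor_mapE tensor_runitE scale1r.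
rewrite !comp_lfunE conj_F2E id_lfunE -(eP v) !tmulZr !linearZ /=.
by rewrite !rE.
Qed.

Section Bialgebra.
Variables (Delta : {linear E -> E \ox E}) (eps : {linear E -> k^o}).
Hypothesis DeltaP : is_coend_comult Delta.
Hypothesis epsP : is_coend_counit eps.

Lemma coend_mult_rank1 (X Y : C) beta x gamma y :
  m (i X (rank1_hom beta x) *t i Y (rank1_hom gamma y)) =
  i (X \tc Y) (rank1_hom (F2_form beta gamma) (F2 F X Y (x *t y))).
Proof. by rewrite mP conj_F2_rank1. Qed.

(** On rank one generators the left-hand side is computed with the resolution
    of F(X (x) Y) formed from bases of F X and F Y, and then agrees with the
    right-hand side term by term. *)
Lemma coend_comultM t :
  Delta (m t) = tensor_map m m (tensor_midswap (tensor_map Delta Delta t)).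
Proof.
have sE := spanning_coend_rank1 (E := E).
move: t; apply: (spanning_tensor sE sE (f := Delta \o m)
  (g := tensor_map m m \o tensor_midswap \o tensor_map Delta Delta)).
move=> _ [_ [_ [[X [beta [x ->]]] [Y [gamma [y ->]]] ->]]] /=.
have vX := @vbasis_resolution _ _ F X; have vY := @vbasis_resolution _ _ F Y.
rewrite coend_mult_rank1 (comultE DeltaP _ _ (F2_resolution vX vY)).
rewrite tensor_mapE (comultE DeltaP _ _ vX) (comultE DeltaP _ _ vY).
rewrite linear_sumlz !linear_sum /=.
under [RHS]eq_bigr do rewrite linear_sumr !linear_sum /=.
rewrite pair_big /=; apply: eq_bigr => a _.
by rewrite tensor_midswapE tensor_mapE !coend_mult_rank1.
Qed.

Lemma coend_counitM t : eps (m t) = tensor_lunit (tensor_map eps eps t).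
Proof.
have sE := spanning_coend_rank1 (E := E).
move: t; apply: (spanning_tensor sE sE (f := eps \o m)
  (g := tensor_lunit \o tensor_map eps eps)).
move=> _ [_ [_ [[X [beta [x ->]]] [Y [gamma [y ->]]] ->]]] /=.
rewrite coend_mult_rank1 tensor_mapE tensor_lunitE !(counitE epsP).
exact: F2_formE.
Qed.

Lemma eta1_rank1 (e : 'Hom(F (tunit M), k^o)) :
  (forall v, (e v : k) *: one = v) -> eta 1 = i (tunit M) (rank1_hom e one).
Proof.
move=> eP; rewrite eta1; congr (i _ _).
by apply/lfunP => v; rewrite id_lfunE rank1_homE eP.
Qed.

(** The identity of F(I) has rank one, and the same vector and form resolve it,
    so the sum defining the comultiplication has a single term. *)
Lemma coend_comult1 : Delta (eta 1) = eta 1 *t eta 1.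
Proof.
have [e [_ eP]] := line_resolution (F_unit F).
have eP1 v : \sum_(a : 'I_1) (e v : k) *: one = v by rewrite big_ord1 eP.
by rewrite (eta1_rank1 eP) (comultE DeltaP _ _ eP1) big_ord1.
Qed.

Lemma coend_counit1 : eps (eta 1) = 1.
Proof.
have [e [e1 eP]] := line_resolution (F_unit F).
by rewrite (eta1_rank1 eP) (counitE epsP).
Qed.

End Bialgebra.
End Algebra.
End CoendProduct.

Theorem proposition3p3 (k : fieldType) (C : linear_category k)
    (C_abelian : abelian C) (M : strict_monoidal C) (F : tensor_functor M)
    (E : coend F) :
  exists (Delta : {linear E -> E \ox E}) (eps : {linear E -> k^o})
         (m : {linear E \ox E -> E}),
    [/\ unique_linear (is_coend_comult (E:=E)) Delta,
        unique_linear (is_coend_counit (E:=E)) eps,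
        unique_linear (is_coend_mult (E:=E)) m
      & is_bialgebra Delta eps m (coend_unit E)].
Proof.
have sE := spanning_coend (E := E).
have [Delta [DeltaP DeltaU]] := coend_universal E (comult_inj_dinatural E).
have [eps [epsP epsU]] := coend_universal E (@counit_dinatural _ _ F).
have [m mP] := coend_mult_exists E.
exists Delta, eps, m; split.
- by split=> [X T|g gP]; [exact: DeltaP | apply: DeltaU].
- by split=> [X T|g gP]; [exact: epsP | apply: epsU].
- split=> // g gP; apply: (spanning_tensor sE sE).
  by move=> _ [_ [_ [[X [S ->]] [Y [T ->]] ->]]]; rewrite mP gP.
split.
- exact: coend_coalgebra.
- split.
  + exact: coend_mult_assoc.
  + exact: coend_mult_unitl.
  + exact: coend_mult_unitr.
- exact: coend_comultM.
- exact: coend_comult1.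
- exact: coend_counitM.
- exact: coend_counit1.
Qed.
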